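(* Let $C_1,\dots,C_k$ be concept classes over sets $X_1,\dots,X_k$, and suppose that each $C_i$ is learnable by an algorithm $A_i$ using only superset queries, where $A_i$ makes $\#\mathrm{Sup}_i(c_i^* )$ superset queries to learn $c_i^*\in C_i$. Then there is an algorithm, using only superset queries, that learns any concept $\prod_{i=1}^k c_i^*$ in the class $\{\prod_{i=1}^k c_i \mid c_i\in C_i\}$ in (at most) $\sum_{i=1}^k \#\mathrm{Sup}_i(c_i^* )$ queries.
   Context: A concept class over a set $X$ is a set of subsets of $X$ (concepts). For a class $D$ with unknown target $c^*\in D$, a superset query takes a concept $c\in D$; the oracle returns `true' if $c\supseteq c^*$, and otherwise returns some (arbitrarily, possibly adversarially chosen) element of $c^*\setminus c$. A learning algorithm for $D$ is an adaptive query strategy that, for every target $c^*\in D$ and every valid behaviour of the oracle, stops after finitely many queries and outputs $c^*$; complexity is measured only by the number of oracle queries. $\#\mathrm{Sup}_i(c_i^* )$ is the (worst-case over valid oracle behaviours) number of queries made by $A_i$ when the target is $c_i^*$. Here $\prod c_i=c_1\times\cdots\times c_k$ is the Cartesian product; queries of the product learner are concepts in the product class. *)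

(* Defs.v *)
From HB Require Import structures.
From mathcomp Require Import all_boot all_order all_algebra.
From mathcomp Require Import boolp classical_sets reals constructive_ereal ereal.

Set Implicit Arguments.
Unset Strict Implicit.
Unset Printing Implicit Defensive.

Local Open Scope classical_set_scope.

Inductive answer (X : Type) : Type :=
| Yes
| Counterexample of X.

(* A class [C : set (set X)] used as a type is the subtype of its members, so
   that queries are concepts of [C] by construction. *)
Definition history (X : Type) (C : set (set X)) : Type := seq (C * answer X).

Inductive action (X : Type) (C : set (set X)) : Type :=
| Query of C
| Output of set X.

(* A history lists the previous queries with their answers, oldest first.
   Only queries are counted, so a strategy is an arbitrary function. *)
Definition strategy (X : Type) (C : set (set X)) : Type :=
  history C -> action C.

(* The answers may depend on the whole conversation so far: the oracle may be
   adaptive and need not answer a repeated query in the same way. *)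
Definition oracle (X : Type) (C : set (set X)) : Type :=
  history C -> C -> answer X.

Definition valid_answer (X : Type) (target query : set X) (a : answer X) :
    Prop :=
  match a with
  | Yes => target `<=` query
  | Counterexample x => (target `\` query) x
  end.

Definition valid_oracle (X : Type) (C : set (set X)) (target : set X)
    (O : oracle C) : Prop :=
  forall (h : history C) (q : C), valid_answer target (\val q) (O h q).

(* [run_from A O h c n]: continuing from the history [h], the strategy [A]
   makes exactly [n] further queries to [O], then stops and outputs [c]. *)
Inductive run_from (X : Type) (C : set (set X)) (A : strategy C)
    (O : oracle C) : history C -> set X -> nat -> Prop :=
| run_output h c : A h = Output C c -> run_from A O h c 0
| run_query h q c n :
    A h = Query q -> run_from A O (rcons h (q, O h q)) c n ->
    run_from A O h c n.+1.

Definition run (X : Type) (C : set (set X)) (A : strategy C) (O : oracle C)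
    (c : set X) (n : nat) : Prop := run_from A O [::] c n.

Definition learns (X : Type) (C : set (set X)) (A : strategy C) : Prop :=
  forall target, C target ->
  forall O : oracle C, valid_oracle target O ->
  exists n, run A O target n.

(* The supremum is taken in the extended reals: every run of a learner is
   finite, but their lengths may be unbounded when counterexamples can be
   chosen in infinitely many ways. *)
Definition num_sup (R : realType) (X : Type) (C : set (set X))
    (A : strategy C) (target : set X) : \bar R :=
  ereal_sup [set (n%:R%:E)%R | n in
    [set n : nat | exists2 O : oracle C, valid_oracle target O &
                   exists c, run A O c n]].

Definition box (k : nat) (X : 'I_k -> Type) (c : forall i, set (X i)) :
    set (forall i, X i) :=
  [set x | forall i, c i (x i)].

Definition box_class (k : nat) (X : 'I_k -> Type)
    (C : forall i, set (set (X i))) : set (set (forall i, X i)) :=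
  [set box c | c in [set c | forall i, C i (c i)]].

(* Main.v *)
(** The product learner simulates all the [A i] at once: it queries the box of
their pending queries, using the output of a learner that has already stopped.
If the target is nonempty, the answer "yes" is a valid "yes" for every factor,
and a counterexample [x] yields the valid counterexample [x i] for each factor
whose pending query misses [x i]; there is one, since a final output contains
[x i]. So each query of the product learner advances some [A i]. If the target
is empty, all answers are "yes", and they are valid for a factor whose concept
is empty: this factor advances at each step until it outputs [set0], and then
the product learner stops. *)

Require Import Defs.
From mathcomp Require Import all_boot all_order all_algebra.
From mathcomp Require Import boolp classical_sets reals constructive_ereal ereal.

Set Implicit Arguments.
Unset Strict Implicit.
Unset Printing Implicit Defensive.

Local Open Scope classical_set_scope.

(** * Transcripts and runs of a single strategy *)

Section Runs.
Variables (X : Type) (C : set (set X)).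
Implicit Types (A : strategy C) (O : oracle C) (h : history C) (T : set X).

(** No oracle is fixed: the answers passed on to a factor depend on the whole product conversation,
    not only on the history of that factor. *)
Inductive reachable A T : history C -> Prop :=
| reachable_nil : reachable A T [::]
| reachable_rcons h q a : reachable A T h -> A h = Query q ->
    valid_answer T (\val q) a -> reachable A T (rcons h (q, a)).

Lemma run_from_Query A O h q c n : A h = Query q -> run_from A O h c n ->
  exists2 m, n = m.+1 & run_from A O (rcons h (q, O h q)) c m.
Proof.
move=> Ah r; case: r Ah => [h' c' -> //|h' q' c' m -> r' [<-]].
by exists m.
Qed.

Lemma run_from_Output A O h d c n : A h = Output C d -> run_from A O h c n ->
  n = 0%N /\ c = d.
Proof. by move=> Ah r; case: r Ah => [h' c' -> [->]//|h' q' c' m ->]. Qed.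

Lemma run_from_inj A O h c1 n1 c2 n2 :
  run_from A O h c1 n1 -> run_from A O h c2 n2 -> n1 = n2.
Proof.
move=> r; elim: r n2 => {h c1 n1} [h c1 Ah|h q c1 n1 Ah _ IH] n2 r2.
  by have [-> _] := run_from_Output Ah r2.
by have [m -> /IH ->] := run_from_Query Ah r2.
Qed.

Lemma valid_answer_exists T (S : set X) : exists a, valid_answer T S a.
Proof.
have [TS|/existsNP[x /not_implyP[Tx Sx]]] := pselect (T `<=` S).
  by exists (Yes X).
by exists (Counterexample x).
Qed.

Definition follows (u : nat -> answer X) h :=
  forall j p, onth h j = Some p -> p.2 = u j.

Lemma follows_rcons u h p :
  follows u (rcons h p) -> follows u h /\ p.2 = u (size h).
Proof.
move=> uh; split=> [j p' hj|]; apply: uh; rewrite -cats1 onth_cat ?ltnn ?subnn//.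
by rewrite -onthTE hj.
Qed.

(** Replay [u] by position where this is valid and give some valid answer elsewhere. *)
Lemma oracle_following T (u : nat -> answer X) :
  exists2 O : oracle C, valid_oracle T O &
    forall h q, valid_answer T (\val q) (u (size h)) -> O h q = u (size h).
Proof.
have [dflt dfltP] := choice (valid_answer_exists T).
exists (fun h q => if pselect (valid_answer T (\val q) (u (size h)))
                   then u (size h) else dflt (\val q)) => h q; case: pselect => //=.
Qed.

(** A strategy is deterministic, so a run that receives the answers recorded in [h] retraces [h]. *)
Lemma run_through A O T u h c m :
    (forall h q, valid_answer T (\val q) (u (size h)) -> O h q = u (size h)) ->
    reachable A T h -> follows u h -> run A O c m ->
  exists2 n, m = (size h + n)%N & run_from A O h c n.
Proof.
move=> Ou rh; elim: rh => {h} [_ r|h q a _ IH Ah Ta uh r]; first by exists m.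
have [/IH/(_ r)[n -> rn] /= ua] := follows_rcons uh.
have [n' -> r'] := run_from_Query Ah rn.
exists n'; first by rewrite size_rcons addSnnS.
by rewrite -[a in (q, a)](_ : O h q = a)// Ou -?ua.
Qed.

Lemma chain_follows (v : nat -> history C) :
    (forall n, exists t, v n.+1 = v n ++ t) ->
  exists u, forall n, follows u (v n).
Proof.
move=> vS.
have vle m n j p : (m <= n)%N -> onth (v m) j = Some p -> onth (v n) j = Some p.
  move=> mn vj; rewrite -(subnKC mn); elim: (n - m)%N => [|d IH]; first by rewrite addn0.
  have [t] := vS (m + d)%N; rewrite addnS => ->.
  by rewrite onth_cat -onthTE IH.
have /choice[u uP] j : exists a, forall n p, onth (v n) j = Some p -> p.2 = a.
  have [[n [p vp]]|no] := pselect (exists n p, onth (v n) j = Some p); last first.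
    (* Arbitrary value: no history of the chain reaches position [j]. *)
    by exists (Yes X) => n p vp; case: no; exists n, p.
  exists p.2 => n' p' vp'; have := vle _ _ _ _ (leq_maxl n n') vp.
  by rewrite (vle _ _ _ _ (leq_maxr n n') vp') => -[->].
by exists u => n j p; apply: uP.
Qed.

(* All transcripts of the chain are prefixes of a single finite run, against an
   oracle that repeats the answers recorded in the chain. *)
Lemma chain_bounded (R : realType) A T (v : nat -> history C) :
    learns A -> C T -> (forall n, reachable A T (v n)) ->
    (forall n, exists t, v n.+1 = v n ++ t) ->
  exists2 m, (forall n, size (v n) <= m)%N &
    ((m%:R%:E)%R <= num_sup R A T)%E.
Proof.
move=> lA CT rv /chain_follows[u uv].
have [O OT Ou] := oracle_following T u.
have [m r] := lA _ CT _ OT.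
exists m => [n|].
  by have [n' -> _] := run_through Ou (rv n) (uv n) r; rewrite leq_addr.
apply: ereal_sup_ubound; exists m => //=; exists O => //.
by exists T.
Qed.

(** The run against an oracle that replays [h] passes through [h] and stops there. *)
Lemma reachable_Output A T h d :
  learns A -> C T -> reachable A T h -> A h = Output C d -> d = T.
Proof.
move=> lA CT rh Ah.
have [n|u /(_ 0%N) uh] := @chain_follows (fun=> h); first by exists [::]; rewrite cats0.
have [O OT Ou] := oracle_following T u.
have [m r] := lA _ CT _ OT.
by have [n _ /(run_from_Output Ah)[_ ->]] := run_through Ou rh uh r.
Qed.

Definition next A O h :=
  if A h is Query q then rcons h (q, O h q) else h.

Lemma next_Query A O h q : A h = Query q -> next A O h = rcons h (q, O h q).
Proof. by rewrite /next => ->. Qed.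

Lemma next_Output A O h c : A h = Output C c -> next A O h = h.
Proof. by rewrite /next => ->. Qed.

Lemma next_Output_run A O n h c : A (iter n (next A O) h) = Output C c ->
  exists2 m, size (iter n (next A O) h) = (size h + m)%N & run_from A O h c m.
Proof.
elim: n h => [|n IH] h.
  by move=> /= Ah; exists 0%N; [rewrite addn0|apply: run_output].
rewrite iterSr; case Ah: (A h) => [q|d]; last by rewrite (next_Output O Ah) => /IH.
rewrite (next_Query O Ah) => /IH[m -> r].
by exists m.+1; [rewrite size_rcons addSnnS|apply: run_query r].
Qed.

Lemma size_iter_next A O n : (exists c, A (iter n (next A O) [::]) = Output C c) \/
  size (iter n (next A O) [::]) = n.
Proof.
elim: n => [|n IH]; [by right|rewrite iterS].
case Ah: (A (iter n (next A O) [::])) => [q|d]; last first.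
  by left; exists d; rewrite (next_Output O Ah).
case: IH => [[c]|sz]; first by rewrite Ah.
by right; rewrite (next_Query O Ah) size_rcons sz.
Qed.

End Runs.

(** * The product learner *)

Section Product.
(* With implicit arguments on, the index [i] of [C i : set (set (X i))] would be
   implicit, because [set] unfolds to a function type. *)
Unset Implicit Arguments.
Variables (k : nat) (X : 'I_k -> Type) (C : forall i, set (set (X i))).
Variable A : forall i : 'I_k, strategy (C i).
Hypothesis A_learns : forall i : 'I_k, learns (A i).
Set Implicit Arguments.

Definition states := forall i : 'I_k, history (C i).

Definition slot (s : states) i : set (X i) :=
  match A i (s i) with Query q => \val q | Output d => d end.

Arguments slot s i : clear implicits.

Definition advance (s : states) (a : answer (forall i, X i)) : states := fun i =>
  if A i (s i) is Query q then
    match a with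
    | Yes => rcons (s i) (q, Yes (X i))
    | Counterexample x =>
        if pselect ((\val q : set (X i)) (x i)) then s i
        else rcons (s i) (q, Counterexample (x i))
    end
  else s i.

Definition states_of (h : history (box_class C)) : states :=
  foldl advance (fun=> [::]) (map snd h).

(* An output [set0] already determines the product. Stopping at it matters when
   the target is empty: the learners of the other factors then receive answers
   that need not fit any concept, and they may never stop. *)
Definition finished (s : states) : Prop :=
  (exists i, A i (s i) = Output (C i) set0) \/
  (forall i, exists d, A i (s i) = Output (C i) d).

(** An output used as a slot may lie outside [C i] when the answers fit no concept, so the box need
    not be a legal query. This happens only for an empty target, hence the default [set0]. *)
Definition product_learner : strategy (box_class C) := fun h =>
  match pselect (box_class C (box (slot (states_of h)))) with
  | left e => if pselect (finished (states_of h))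
              then Output _ (box (slot (states_of h)))
              else Query (SigSub (mem_set e))
  | right _ => Output _ set0
  end.

Lemma states_of_rcons h p : states_of (rcons h p) = advance (states_of h) p.2.
Proof. by rewrite /states_of map_rcons foldl_rcons. Qed.

(** * Correctness and progress for a fixed target *)

Section Target.
Unset Implicit Arguments.
Variable c : forall i, set (X i).
Set Implicit Arguments.
Hypothesis Cc : forall i : 'I_k, C i (c i).

(* The factors whose learner is guaranteed to receive valid answers. *)
Definition reliable i := box c !=set0 \/ c i = set0.

Definition consistent (s : states) :=
  forall i, reliable i -> reachable (A i) (c i) (s i).

Lemma box_empty_factor : ~ (box c !=set0) -> exists i, c i = set0.
Proof.
move=> T0; apply: contrapT => /forallNP cn0; apply: T0.
have cx i : exists x, c i x by apply/set0P/eqP/cn0.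
by exists (fun i => sval (cid (cx i))) => i; case: cid.
Qed.

Lemma box_empty i : c i = set0 -> box c = set0.
Proof.
by move=> ci; apply/nonemptyPn => -[t /(_ i)]; rewrite ci.
Qed.

Lemma reliable_Output s i d : consistent s -> reliable i ->
  A i (s i) = Output (C i) d -> d = c i.
Proof.
move=> cs ri; exact: (reachable_Output (@A_learns i) (Cc i) (cs _ ri)).
Qed.

Lemma product_learner_Output h d : consistent (states_of h) ->
  product_learner h = Output _ d -> d = box c.
Proof.
move=> cs; rewrite /product_learner.
have [T0|/[dup] T0 /box_empty_factor[i ci]] := pselect (box c !=set0); last first.
  have ri : reliable i by right.
  move/nonemptyPn: T0 => ->.
  case: pselect => [e|_ [<-]//]; case: pselect => // fin [<-].
  (* If all learners have stopped, the one with [c i] empty is reliable and has output [set0]. *)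
  have [j Aj] : exists j, A j (states_of h j) = Output (C j) set0.
    by case: fin => // /(_ i)[d' Ai]; exists i; rewrite Ai (reliable_Output cs ri Ai) ci.
  by apply/nonemptyPn => -[t /(_ j)]; rewrite /slot Aj.
have rel i : reliable i by left.
have slotC i : C i (slot (states_of h) i).
  rewrite /slot; case Ai: (A i _) => [q|d']; first exact/set_mem/(valP q).
  by rewrite (reliable_Output cs (rel i) Ai).
case: pselect => [e|[]]; last by exists (slot (states_of h)).
case: pselect => // -[[i Ai]|fin] [<-].
  have ci := esym (reliable_Output cs (rel i) Ai).
  by move: T0; rewrite (box_empty ci) => /set0P/eqP.
congr box; apply: functional_extensionality_dep => i; rewrite /slot.
by have [d' Ai] := fin i; rewrite Ai (reliable_Output cs (rel i) Ai).
Qed.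

Lemma advance_valid s a i q : consistent s -> reliable i ->
    valid_answer (box c) (box (slot s)) a -> A i (s i) = Query q ->
  reachable (A i) (c i) (advance s a i).
Proof.
move=> cs ri va Ai; rewrite /advance Ai.
have ci := cs _ ri.
case: a va => [cslot|x [cx _]]; last first.
  by case: pselect => // qx; apply: reachable_rcons => //; split.
apply: reachable_rcons => // y cy.
case: ri => [[t ct]|c0]; last by rewrite c0 in cy.
(* Replacing coordinate [i] of a target point [t] by [y] stays in the target, hence in the queried
   box. *)
have /cslot/(_ i) : box c (dfwith t y).
  move=> j; have [<-|ij] := eqVneq i j; first by rewrite dfwith_in.
  by rewrite dfwith_out.
by rewrite dfwith_in /slot Ai.
Qed.

Lemma consistent_advance s a : consistent s ->
  valid_answer (box c) (box (slot s)) a -> consistent (advance s a).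
Proof.
move=> cs va i ri; case Ai: (A i (s i)) => [q|d]; first exact: advance_valid va Ai.
by rewrite /advance Ai; exact: cs.
Qed.

Lemma advance_prefix s a i : exists t, advance s a i = s i ++ t.
Proof.
rewrite /advance; case: (A i (s i)) => [q|d]; last by exists [::]; rewrite cats0.
case: a => [|x]; first by eexists; rewrite -cats1.
by case: pselect => ?; [exists [::]; rewrite cats0|eexists; rewrite -cats1].
Qed.

Lemma size_advance s a i : (size (s i) <= size (advance s a i))%N.
Proof. by have [t ->] := advance_prefix s a i; rewrite size_cat leq_addr. Qed.

Lemma advance_progress s a : consistent s -> ~ finished s ->
    valid_answer (box c) (box (slot s)) a ->
  exists2 i, reliable i & (size (s i) < size (advance s a i))%N.
Proof.
move=> cs /not_orP[no0 noall] va.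
case: a va => [_|x [cx slotx]]; last first.
  have rel i : reliable i by left; exists x.
  have /existsNP[i slotxi] := slotx.
  exists i => //; move: slotxi; rewrite /slot /advance.
  case Ai: (A i (s i)) => [q|d]; last first.
    by rewrite (reliable_Output cs (rel i) Ai); have := cx i.
  by move=> slotxi; case: pselect => [qx|nqx]; [case: slotxi|rewrite size_rcons].
(* After a yes, every factor with a pending query advances. *)
suff [i ri [q Ai]] : exists2 i, reliable i & exists q, A i (s i) = Query q.
  by exists i => //; rewrite /advance Ai size_rcons.
have [T0|/box_empty_factor[i ci]] := pselect (box c !=set0).
  have /existsNP[i noout] := noall; exists i; first by left.
  case Ai: (A i (s i)) => [q|d]; first by exists q.
  by case: noout; exists d.
have ri : reliable i by right.
exists i => //; case Ai: (A i (s i)) => [q|d]; first by exists q.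
by case: no0; exists i; rewrite Ai (reliable_Output cs ri Ai) ci.
Qed.

(** * Counting queries against a fixed oracle *)

Section Run.
Variable O : oracle (box_class C).
Hypothesis OT : valid_oracle (box c) O.

Let hist n := iter n (next product_learner O) [::].

Lemma states_next h q : product_learner h = Query q ->
  states_of (next product_learner O h) = advance (states_of h) (O h q).
Proof. by move=> Bh; rewrite (next_Query O Bh) states_of_rcons. Qed.

Lemma product_learner_Query h q : product_learner h = Query q ->
  ~ finished (states_of h) /\ \val q = box (slot (states_of h)).
Proof.
rewrite /product_learner; case: pselect => // e; case: pselect => // nf [<-].
by split.
Qed.

Lemma consistent_hist n : consistent (states_of (hist n)).
Proof.
elim: n => [i _|n IH]; first exact: reachable_nil.
rewrite /hist iterS -/(hist n).
case Bh: (product_learner (hist n)) => [q|d]; last by rewrite (next_Output O Bh).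
rewrite (states_next Bh); apply: consistent_advance => //.
by have [_ <-] := product_learner_Query Bh; exact: OT.
Qed.

(** Each query lengthens some reliable history and shortens none. *)
Lemma size_hist n : (size (hist n) <=
  \sum_(i < k | `[< reliable i >]) size (states_of (hist n) i))%N.
Proof.
elim: n => [//|n IH]; rewrite /hist iterS -/(hist n).
case Bh: (product_learner (hist n)) => [q|d]; last by rewrite (next_Output O Bh).
have [nf vq] := product_learner_Query Bh.
rewrite (states_next Bh) (next_Query O Bh) size_rcons.
have [|i ri lti] := advance_progress (a := O (hist n) q) (@consistent_hist n) nf.
  by rewrite -vq; exact: OT.
apply: leq_ltn_trans IH _.
have Ri : `[< reliable i >] by apply/asboolP.
rewrite (bigD1 i)//= [ltnRHS](bigD1 i)//= -addSn leq_add// leq_sum// => j _.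
exact: size_advance.
Qed.

Lemma factor_bound (R : realType) i : exists m,
  (reliable i -> forall n, size (states_of (hist n) i) <= m)%N /\
  ((m%:R%:E)%R <= num_sup R (A i) (c i))%E.
Proof.
have [ri|nri] := pselect (reliable i); last first.
  (* An unreliable factor only needs some [m] below [num_sup]; the constant chain of empty histories
     provides one. *)
  have [||m _ mle] := @chain_bounded _ _ R _ _ (fun=> [::]) (@A_learns i) (Cc i).
  - by move=> _; exact: reachable_nil.
  - by exists [::].
  by exists m.
have [||m mP mle] := @chain_bounded _ _ R _ _
  (fun n => states_of (hist n) i) (@A_learns i) (Cc i).
- by move=> n; exact: consistent_hist.
- move=> n; rewrite /hist iterS -/(hist n).
  case Bh: (product_learner (hist n)) => [q|d].
    by rewrite (states_next Bh); exact: advance_prefix.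
  by rewrite (next_Output O Bh); exists [::]; rewrite cats0.
by exists m.
Qed.

Lemma product_learner_run (R : realType) : exists2 n,
  run product_learner O (box c) n &
  ((n%:R%:E)%R <= \sum_(i < k) num_sup R (A i) (c i))%E.
Proof.
have /choice[m mP] := factor_bound R.
pose M := (\sum_(i < k) m i)%N.
have histM n : (size (hist n) <= M)%N.
  apply: leq_trans (size_hist n) _; rewrite /M [leqRHS](bigID (fun i => `[< reliable i >]))/=.
  apply: leq_trans (leq_addr _ _); apply: leq_sum => i /asboolP ri.
  exact: (mP i).1.
(* Without an output, [M.+1] steps would make [M.+1] queries, against the bound [M]. *)
have [[d Bd]|szM] := size_iter_next product_learner O M.+1; last first.
  by have := histM M.+1; rewrite /hist szM ltnn.
have dT := product_learner_Output (@consistent_hist M.+1) Bd.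
have [n szn] := next_Output_run Bd; rewrite dT => r.
exists n => //; apply: Order.POrderTheory.le_trans (_ : (M%:R%:E)%R <= _)%E.
  by rewrite lee_fin Num.Theory.ler_nat; have := histM M.+1; rewrite /hist szn.
rewrite /M GRing.natr_sum -sumEFin; apply: lee_sum => i _; exact: (mP i).2.
Qed.

End Run.
End Target.

End Product.

Theorem proposition3 (R : realType) (k : nat) (X : 'I_k -> Type)
    (C : forall i : 'I_k, set (set (X i)))
    (A : forall i : 'I_k, strategy (C i))
    (A_learns : forall i : 'I_k, learns (A i)) :
  exists B : strategy (box_class C),
    learns B /\
    forall c : forall i : 'I_k, set (X i),
      (forall i : 'I_k, C i (c i)) ->
      (num_sup R B (box c) <= \sum_(i < k) num_sup R (A i) (c i))%E.
Proof.
exists (product_learner A); split=> [_ [c Cc <-] O OT|c Cc].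
  by have [n r _] := product_learner_run A_learns Cc OT R; exists n.
apply: ge_ereal_sup => _ [n [O OT [d r]] <-].
have [m r' mle] := product_learner_run A_learns Cc OT R.
(* The oracle determines the length of the run, so the bound for [r'] applies to [r]. *)
by rewrite (run_from_inj r r').
Qed.
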